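(* Let $\mathbb{N}=\{0,1,2,\dots\}$ and let $\mathcal{A}$ be the family of all functions $f_{a,b}:\mathbb{N}\to\mathbb{N}$, $f_{a,b}(n)=an+b$, with $a,b\in\mathbb{N}$, $a\neq 0$. Let $G:\mathbb{N}\times\mathbb{N}^2\to\mathbb{N}$ be given by $G(n,(a,b))=an+b$, let $R=\mathbb{N}^2\setminus\{(0,n)\mid n\in\mathbb{N}\}$ and let $\Theta_R=\{\mathcal{V}\in\beta(\mathbb{N}^2)\mid R\in\mathcal{V}\}$. Then: (1) $M(\beta\mathbb{N},\mathcal{A})=\{\mathcal{U}\in\beta\mathbb{N}\mid\text{every }A\in\mathcal{U}\text{ is AP-rich}\}$; (2) for every $\mathcal{U}\in\overline{K(\beta\mathbb{N},\oplus)}\cup\overline{K(\beta\mathbb{N},\odot)}$, $M(\beta\mathbb{N},\mathcal{A})=\overline{\{\overline{G}(\mathcal{U}\otimes\mathcal{V})\mid\mathcal{V}\in\Theta_R\}}$; (3) a set $A\subseteq\mathbb{N}$ is AP-rich if and only if for every $\mathcal{U}\in\overline{K(\beta\mathbb{N},\oplus)}$ there exists $\mathcal{V}\in\Theta_R$ such that $A\in\overline{G}(\mathcal{U}\otimes\mathcal{V})$. Here bars over sets of ultrafilters denote closure in the Stone topology of $\beta\mathbb{N}$.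
   Context: A set $A\subseteq\mathbb{N}$ is AP-rich if it contains arbitrarily long arithmetic progressions. For $\mathcal{U}\in\beta\mathbb{N}$ and $\mathcal{V}\in\beta(\mathbb{N}^2)$, the ultrafilter $\overline{G}(\mathcal{U}\otimes\mathcal{V})\in\beta\mathbb{N}$ is characterized by: $A\in\overline{G}(\mathcal{U}\otimes\mathcal{V})$ if and only if $\{n\in\mathbb{N}\mid\{(a,b)\in\mathbb{N}^2\mid an+b\in A\}\in\mathcal{V}\}\in\mathcal{U}$. For $A,B\subseteq\mathbb{N}$, $A\leq_{\mathcal{A}}B$ means that for every finite $F\subseteq A$ there is $f\in\mathcal{A}$ with $f(F)\subseteq B$. For $\mathcal{U},\mathcal{V}\in\beta\mathbb{N}$, $\mathcal{U}\leq_{\mathcal{A}}\mathcal{V}$ means that for every $B\in\mathcal{V}$ there is $A\in\mathcal{U}$ with $A\leq_{\mathcal{A}}B$. $M(\beta\mathbb{N},\mathcal{A})$ is the set of maximal ultrafilters, i.e. of those $\mathcal{U}\in\beta\mathbb{N}$ with $\mathcal{V}\leq_{\mathcal{A}}\mathcal{U}$ for every $\mathcal{V}\in\beta\mathbb{N}$. For an operation $*$ on $\mathbb{N}$ (addition or multiplication), its extension to $\beta\mathbb{N}$ (denoted $\oplus$, resp. $\odot$) is given by: $A$ belongs to the product of $\mathcal{U}$ and $\mathcal{V}$ iff $\{s\in\mathbb{N}\mid\{r\in\mathbb{N}\mid s*r\in A\}\in\mathcal{V}\}\in\mathcal{U}$. $K(\beta\mathbb{N},\oplus)$ and $K(\beta\mathbb{N},\odot)$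 are the minimal bilateral (two-sided) ideals of the respective semigroups.
   Formalization: K(βℕ,⊙) is taken as the minimal bilateral ideal of the multiplicative semigroup of ultrafilters containing the positive integers; with 0 in ℕ the literal ideal is {0}, the principal ultrafilter at 0, and (2) fails there since the right-hand side is all of βℕ. *)

(* Defs.v *)
From HB Require Import structures.
From mathcomp Require Import all_boot all_order.
From mathcomp Require Import boolp classical_sets functions cardinality filter.
From mathcomp Require Import topology.

Set Implicit Arguments.
Unset Strict Implicit.
Unset Printing Implicit Defensive.

Local Open Scope classical_set_scope.

(* beta T is the set of ultrafilters on the discrete space T; U A reads
   "A is a member of U". *)
Record beta (T : Type) := Beta {
  beta_mem :> set T -> Prop;
  beta_ultra : UltraFilter (beta_mem : set_system T) }.

#[global] Existing Instance beta_ultra.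

Lemma beta_memP {T : Type} (U : beta T) (A : set T) : U A \/ U (~` A).
Proof. exact: in_ultra_setVsetC. Qed.

Lemma beta_eqP {T : Type} (U V : beta T) :
  (forall A, U A <-> V A) -> U = V.
Proof.
case: U V => [F FU] [G GU] /= FG.
have E : F = G by apply/funext => A; apply/propext; exact: FG.
by move: FU GU; rewrite E => FU GU; congr Beta; exact: Prop_irrelevance.
Qed.

Lemma ultra_of_dichotomy {T : Type} (F : set_system T) :
  ProperFilter F -> (forall A, F A \/ F (~` A)) -> UltraFilter F.
Proof.
move=> PF dF; split=> // G PG FG; apply/seteqP; split => // A GA.
case: (dF A) => // /FG GnA.
by have [x []] := filter_ex (filterI GA GnA).
Qed.

(* The Stone topology: the sets {U | A in U}, for A a subset of T, form a base. *)
Section StoneTopology.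
Variable T : Type.

HB.instance Definition _ := gen_eqMixin (beta T).
HB.instance Definition _ := gen_choiceMixin (beta T).

Definition stone_open (A : set T) : set (beta T) := [set U : beta T | U A].

Let stone_cover : \bigcup_(A in [set: set T]) stone_open A = [set: beta T].
Proof.
by apply/seteqP; split=> // U _; exists setT => //; exact: filterT.
Qed.

Let stone_join (A B : set T) (U : beta T) : setT A -> setT B ->
  stone_open A U -> stone_open B U ->
  exists C, [/\ setT C, stone_open C U &
    stone_open C `<=` stone_open A `&` stone_open B].
Proof.
move=> _ _ UA UB; exists (A `&` B); split => //; first exact: filterI.
by move=> V VAB; split; apply: filterS VAB => x [].
Qed.

HB.instance Definition _ :=
  isBaseTopological.Build (beta T) stone_cover stone_join.
End StoneTopology.

(* beta_map f is the continuous extension of f, written f with a bar. *)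
Section BetaMap.
Variables (S T : Type) (f : S -> T).

Fact beta_map_ultra (U : beta S) :
  UltraFilter ([set A | U (f @^-1` A)] : set_system T).
Proof.
exact: ultra_of_dichotomy (fmap_proper_filter f _)
  (fun A => beta_memP U (f @^-1` A)).
Qed.

Definition beta_map (U : beta S) : beta T := Beta (beta_map_ultra U).
End BetaMap.

Section Tensor.
Variables (S T : Type).

Fact tensor_ultra (U : beta S) (V : beta T) :
  UltraFilter ([set A | U [set x | V [set y | A (x, y)]]]
    : set_system (S * T)).
Proof.
apply: ultra_of_dichotomy => [|A]; last first.
  have [|UnA] := beta_memP U [set x | V [set y | A (x, y)]]; first by left.
  right; apply: (@filterS _ U _ _ _ _ UnA) => x /= nVA.
  by have [//|] := beta_memP V [set y | A (x, y)].
split=> /= [U0|].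
  have [x] := @filter_ex _ U _ _ U0; exact: (@filter_not_empty _ V).
split=> /=.
- by apply: (@filterE _ U) => x /=; exact: (@filterT _ V).
- move=> A B UA UB; apply: (@filterS2 _ U _ _ _ _ _ UA UB) => x /= VA VB.
  exact: (@filterI _ V).
- move=> A B AB; apply: (@filterS _ U) => x /=.
  by apply: (@filterS _ V) => y; exact: AB.
Qed.

Definition tensor (U : beta S) (V : beta T) : beta (S * T) :=
  Beta (tensor_ultra U V).
End Tensor.

Definition beta_op (op : nat -> nat -> nat) (U V : beta nat) : beta nat :=
  beta_map (fun p => op p.1 p.2) (tensor U V).

Lemma beta_opE op U V (A : set nat) :
  beta_op op U V A = U [set s | V [set r | A (op s r)]].
Proof. by []. Qed.

(* Bilateral ideals of a subsemigroup S of (X, mul). *)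
Definition bilateral_ideal (X : Type) (mul : X -> X -> X) (S I : set X) :=
  [/\ I !=set0, I `<=` S &
      forall s u, S s -> I u -> I (mul s u) /\ I (mul u s)].

Definition minimal_bilateral_ideal (X : Type) (mul : X -> X -> X)
    (S I : set X) :=
  bilateral_ideal mul S I /\
  forall J, bilateral_ideal mul S J -> J `<=` I -> J = I.

(* In a semigroup two bilateral ideals always meet, so there is at most one
   minimal bilateral ideal; the union below is that ideal (see
   minimal_ideal_unique). *)
Definition minimal_ideal (X : Type) (mul : X -> X -> X) (S : set X) : set X :=
  \bigcup_(I in minimal_bilateral_ideal mul S) I.

Lemma minimal_ideal_unique (X : Type) (mul : X -> X -> X) (S I : set X) :
  associative mul ->
  minimal_bilateral_ideal mul S I -> minimal_ideal mul S = I.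
Proof.
move=> mulA Imin; apply/seteqP; split=> [x [J Jmin Jx]|x Ix]; last by exists I.
suff -> : I = J by [].
case: Imin Jmin => -[[i Ii] IS II] mI [[[j Jj] JS JJ] mJ].
have IJ : bilateral_ideal mul S (I `&` J).
  split.
  - exists (mul i j); split; first by apply: (II j i _ Ii).2; exact: JS.
    by apply: (JJ i j _ Jj).1; exact: IS.
  - by move=> y [/IS].
  - move=> s u Ss [Iu Ju]; have [? ?] := II s u Ss Iu.
    by have [? ?] := JJ s u Ss Ju; split.
by rewrite -(mI _ IJ (@subIsetl _ _ _)) (mJ _ IJ (@subIsetr _ _ _)).
Qed.

Definition K_add : set (beta nat) := minimal_ideal (beta_op addn) setT.

(* The principal ultrafilter at 0 is a zero of (beta nat, beta_op muln), so
   the minimal bilateral ideal of that whole semigroup is just {0}.  The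
   multiplicative ideal is therefore taken in the subsemigroup of the
   ultrafilters on the positive integers. *)
Definition beta_pos : set (beta nat) := [set U : beta nat | U [set n | 0 < n]].

Definition K_mul : set (beta nat) := minimal_ideal (beta_op muln) beta_pos.

Definition AP_rich (A : set nat) : Prop :=
  forall k, exists a d, 0 < d /\ forall i, i < k -> A (a + i * d).

Section Embeddability.
Variable Fam : set (nat -> nat).

Definition set_embed (A B : set nat) : Prop :=
  forall F, finite_set F -> F `<=` A -> exists2 f, Fam f & f @` F `<=` B.

Definition ultra_embed (U V : beta nat) : Prop :=
  forall B, V B -> exists2 A, U A & set_embed A B.

Definition maximal_ultra : set (beta nat) :=
  [set U | forall V, ultra_embed V U].
End Embeddability.

Definition affine : set (nat -> nat) :=
  [set f | exists a b, a <> 0 /\ f = (fun n => a * n + b)].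

Definition G (p : nat * (nat * nat)) : nat := p.2.1 * p.1 + p.2.2.

Definition R : set (nat * nat) := ~` [set (0, n) | n in [set: nat]].

Definition Theta_R : set (beta (nat * nat)) :=
  [set V : beta (nat * nat) | V R].

(* Main.v *)
Require Import Defs.
From mathcomp Require Import all_boot all_order.
From mathcomp Require Import boolp classical_sets functions cardinality filter.
From mathcomp Require Import topology.
From mathcomp Require Import zify.

Set Implicit Arguments.
Unset Strict Implicit.
Unset Printing Implicit Defensive.

Local Open Scope classical_set_scope.

(* By van der Waerden's theorem AP-richness is partition regular, so the set
   [rich_ultra] of the ultrafilters with only AP-rich members is nonempty.  It
   is closed and is a bilateral ideal for both operations, hence contains the
   closures of both minimal ideals.
   Composing with the affine maps of R preserves AP-richness, so
   G(U (x) V) stays in [rich_ultra]; conversely, an AP-rich set A contains a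
   copy an + b (n < k) of every initial segment of the naturals, so the sets of
   such pairs (a, b) have the finite intersection property and an ultrafilter V
   on them gives A in G(U (x) V), whatever U is.  In (3) one also needs
   [K_add] to be nonempty, which comes from a minimal left ideal. *)

(** * Van der Waerden's theorem by colour focusing *)

(** Induction on the number [s] of progressions of distinct colours that all have the focus [f] as
    next term. If [f] has one of their colours, that progression grows to length [k.+1]; otherwise
    [f] contributes a new colour. *)
Lemma color_focusing (k : nat) (C : finType) : 0 < k ->
  (forall D : finType, exists N, forall c : nat -> D,
     exists a d, [/\ 0 < d, a + k * d <= N &
       forall i, i < k -> c (a + i * d) = c a]) ->
  forall s, s <= #|C| -> exists N, forall c : nat -> C,
    (exists a d x, [/\ 0 < d, a + k.+1 * d <= N &
       forall i, i < k.+1 -> c (a + i * d) = x]) \/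
    exists f (X : {set C}), [/\ f <= N, #|X| = s &
      forall x, x \in X -> exists a d, [/\ 0 < d, a + k * d = f &
        forall i, i < k -> c (a + i * d) = x]].
Proof.
move=> k0 vdWk; elim=> [_|s IHs sC].
  exists 0 => c; right; exists 0, finset.set0; rewrite cards0; split=> // x.
  by rewrite inE.
have [N PN] := IHs (ltnW sC); pose M := N.+1.
(* Blocks of length [M] are coloured by their whole pattern, which gives [k] equally spaced
   identical blocks. *)
have [N' PN'] := vdWk {ffun 'I_M -> C}.
(* The bound asks for one difference beyond the focus: [e <= k * e <= f <= N], hence [2 * N]. *)
exists (N' * M + 2 * N) => c.
have [a [d [d0 adN' cad]]] := PN' (fun j => [ffun t : 'I_M => c (j * M + t)]).
have block i t : i < k -> t < M -> c ((a + i * d) * M + t) = c (a * M + t).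
  by move=> ik tM; have /ffunP/(_ (Ordinal tM)) := cad i ik; rewrite !ffunE.
have aN' : a <= N' by lia.
have aM : a * M <= N' * M by rewrite leq_mul2r aN' orbT.
have [[b [e [x [e0 beN ce]]]]|[f [X [fN Xs cX]]]] :=
    PN (fun t => c (a * M + t)).
  left; exists (a * M + b), e, x; split=> //; first by lia.
  by move=> i ik; rewrite -addnA ce.
have [fX|fX] := boolP (c (a * M + f) \in X).
  have [b [e [e0 bef cbe]]] := cX _ fX.
  left; exists (a * M + b), e, (c (a * M + f)); split=> //.
    by have := leq_pmull e k0; lia.
  move=> i; rewrite ltnS leq_eqVlt -addnA => /orP[/eqP ->|ik].
    by rewrite bef.
  exact: cbe.
(* The new focus is the position of [f] in block [a + k * d]. The copies of [f] in the [k] earlier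
   blocks carry the new colour; the old progressions move one step of blocks per term, so their
   differences grow by [d * M]. *)
right; exists ((a + k * d) * M + f), (c (a * M + f) |: X)%SET; split.
- have : (a + k * d) * M <= N' * M by rewrite leq_mul2r adN' orbT.
  lia.
- by rewrite cardsU1 fX Xs.
move=> x; rewrite in_setU1 => /orP[/eqP ->|xX].
  exists (a * M + f), (d * M); split; first by rewrite muln_gt0 d0.
    by lia.
  move=> i ik; rewrite -(block i f) //.
  by congr c; lia.
have [b [e [e0 bef cbe]]] := cX _ xX.
exists (a * M + b), (d * M + e); split; first by lia.
  by rewrite -bef; lia.
move=> i ik; rewrite -(cbe i ik) -(block i (b + i * e)) //; last first.
  have : i * e <= k * e by rewrite leq_mul2r (ltnW ik) orbT.
  by lia.
by congr c; lia.
Qed.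

Lemma van_der_Waerden (k : nat) (D : finType) :
  exists N, forall c : nat -> D,
     exists a d, [/\ 0 < d, a + k * d <= N &
       forall i, i < k -> c (a + i * d) = c a].
Proof.
elim: k D => [|[_|k IHk]] D.
- by exists 0 => c; exists 0, 1.
- by exists 1 => c; exists 0, 1; split=> // -[].
have [N PN] := color_focusing (ltn0Sn k) IHk (leqnn #|D|).
exists (2 * N) => c.
have [[a [d [x [d0 adN cx]]]]|[f [X [fN XD cX]]]] := PN c.
  exists a, d; split=> //; first by lia.
  by move=> i ik; rewrite (cx i ik) -(cx 0 isT) mul0n addn0.
(* [#|D|] distinct colours exhaust [D], so the focus extends one of the progressions. *)
have fX : c f \in X.
  suff -> : X = finset.setT by rewrite finset.in_setT.
  by apply/eqP; rewrite eqEcard finset.subsetT cardsT XD /=.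
have [a [d [d0 adf cx]]] := cX _ fX.
have cf i : i < k.+2 -> c (a + i * d) = c f.
  by rewrite ltnS leq_eqVlt => /orP[/eqP ->|/cx //]; rewrite adf.
exists a, d; split=> //; first by lia.
by move=> i /cf ->; rewrite -(cf 0 isT) mul0n addn0.
Qed.

(** * Partition regularity of AP-richness *)

Lemma AP_richS (A B : set nat) : A `<=` B -> AP_rich A -> AP_rich B.
Proof.
move=> AB rA k; have [a [d [d0 Aad]]] := rA k.
by exists a, d; split=> // i /Aad/AB.
Qed.

(** The indices of a long progression in the union are coloured by membership in [A]. If [A] has no
    progression of length [k1], a monochromatic one of length [k1 + k] misses [A] and so lies in
    [B]. *)
Lemma AP_rich_setU (A B : set nat) :
  AP_rich (A `|` B) -> AP_rich A \/ AP_rich B.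
Proof.
move=> rAB; have [|/existsNP[k1 nA]] := pselect (AP_rich A); first by left.
right=> k; have [N PN] := van_der_Waerden (k1 + k) bool.
have [a [d [d0 ABad]]] := rAB N.+1.
have [b [e [e0 beN cbe]]] := PN (fun i => `[< A (a + i * d) >]).
have APE i : a + b * d + i * (e * d) = a + (b + i * e) * d by lia.
exists (a + b * d), (e * d); rewrite muln_gt0 d0 e0; split=> // i ik.
have [Ab|nAb] := pselect (A (a + b * d)).
  case: nA; exists (a + b * d), (e * d); rewrite muln_gt0 d0 e0.
  split=> // j jk; rewrite APE; apply/asboolP; rewrite cbe ?asboolE //; lia.
rewrite APE; have [] := ABad (b + i * e).
- have : i * e <= (k1 + k) * e by rewrite leq_mul2r; lia.
  by lia.
- by move/asboolP; rewrite cbe ?asboolE //; lia.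
- by [].
Qed.

Lemma AP_rich_affine (a b : nat) (A : set nat) :
  0 < a -> AP_rich [set n | A (a * n + b)] -> AP_rich A.
Proof.
move=> a0 rA k; have [c [d [d0 Acd]]] := rA k.
exists (a * c + b), (a * d); rewrite muln_gt0 a0; split=> // i /Acd /=.
by rewrite mulnDr addnAC mulnCA.
Qed.

Lemma AP_richT : AP_rich [set: nat].
Proof. by move=> k; exists 0, 1. Qed.

Lemma AP_rich0 : ~ AP_rich set0.
Proof. by move=> /(_ 1)[a [d [_ /(_ 0 isT)]]]. Qed.

(** * Ultrafilters and closures in the Stone topology *)

Lemma beta_extend (T : Type) (F : set_system T) :
  F setT -> (forall A B, F A -> F B -> F (A `&` B)) ->
  (forall A, F A -> A !=set0) -> exists U : beta T, F `<=` U.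
Proof.
move=> FT FI F0.
have PF : ProperFilter (filter_from F id).
  apply: filter_from_proper => //.
  apply: filter_from_filter; first by exists setT.
  by move=> A B FA FB; exists (A `&` B) => //; exact: FI.
have [U [UU FU]] := ultraFilterLemma PF.
by exists (Beta UU) => A FA; apply: FU; exists A.
Qed.

Lemma beta_ex (T : Type) (U : beta T) (A : set T) : U A -> A !=set0.
Proof. exact: filter_ex. Qed.

Lemma beta_finI (T : Type) (U : beta T) (P : nat -> set T) (k : nat) :
  (forall i, i < k -> U (P i)) -> U [set x | forall i, i < k -> P i x].
Proof.
elim: k => [_|k IHk UP]; first exact: filterE.
have Uk := IHk (fun i ik => UP i (ltnW ik)).
apply: filterS (filterI Uk (UP k (ltnSn k))) => x [Px Pkx] i.
by rewrite ltnS leq_eqVlt => /orP[/eqP ->|/Px].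
Qed.

Lemma closure_betaP (T : Type) (E : set (beta T)) (U : beta T) :
  closure E U <-> forall A : set T, U A -> exists2 V, E V & V A.
Proof.
split=> [EU A UA|EU B].
  have [|V [EV VA]] := EU (stone_open A); last by exists V.
  apply: open_nbhs_nbhs; split=> //.
  by exists [set A] => //; rewrite bigcup_set1.
rewrite nbhsE => -[_ [[D _ <-] [A DA UA]] DB].
by have [V EV VA] := EU A UA; exists V; split=> //; apply: DB; exists A.
Qed.

(** * Ultrafilters of AP-rich sets *)

Definition rich_ultra : set (beta nat) :=
  [set U | forall A, U A -> AP_rich A].

(** By partition regularity the sets whose complement is not AP-rich are closed under intersection.
    An ultrafilter containing them contains the complement of every set that is not AP-rich. *)
Lemma rich_ultra_neq0 : rich_ultra !=set0.
Proof.
have [||A|U FU] := @beta_extend nat [set A | ~ AP_rich (~` A)].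
- by rewrite /= setCT; exact: AP_rich0.
- by move=> A B /= nA nB; rewrite setCI => /AP_rich_setU[].
- rewrite -set0P; apply: contra_notN => /eqP ->.
  by rewrite setC0; exact: AP_richT.
exists U => A UA; apply: contrapT => nA.
have UnA : U (~` A) by apply: FU => /=; rewrite setCK.
by have [x []] := beta_ex (filterI UA UnA).
Qed.

Lemma closure_rich_ultra : closure rich_ultra `<=` rich_ultra.
Proof. by move=> U /closure_betaP rU A /rU[V rV /rV]. Qed.

Lemma R_gt0 (a b : nat) : R (a, b) <-> 0 < a.
Proof.
split=> [Rab|a0 [n _ [a0']]]; last by rewrite -a0' in a0.
by rewrite lt0n; apply/eqP => a0; apply: Rab; exists b; rewrite ?a0.
Qed.

(** Finite intersections in [V] provide a single pair of [R] that sends all [k] terms of a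
    progression into [A]. *)
Lemma rich_ultra_G (U : beta nat) (V : beta (nat * nat)) :
  rich_ultra U -> Theta_R V -> rich_ultra (beta_map G (tensor U V)).
Proof.
move=> rU RV A UVA k; have [c [d [d0 Vcd]]] := rU _ UVA k.
have [[a b] [/R_gt0 a0 Aab]] := beta_ex (filterI RV (beta_finI Vcd)).
exists (a * c + b), (a * d); rewrite muln_gt0 a0; split=> // i /Aab.
by rewrite /G /= mulnDr addnAC mulnCA.
Qed.

Lemma AP_rich_G (U : beta nat) (A : set nat) : AP_rich A ->
  exists2 V, Theta_R V & beta_map G (tensor U V) A.
Proof.
move=> rA; pose P k := [set p | 0 < p.1 /\ forall n, n < k -> A (G (n, p))].
have [|||V PV] := @beta_extend (nat * nat) [set B | exists k, P k `<=` B].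
- by exists 0.
- move=> B C [k kB] [l lC]; exists (maxn k l) => p [p0 Ap].
  by split; [apply: kB|apply: lC]; split=> // n nk; apply: Ap;
    rewrite leq_max nk ?orbT.
- move=> B [k kB]; have [a [d [d0 Aad]]] := rA k; exists (d, a); apply: kB.
  by split=> // n /Aad; rewrite /G /= addnC mulnC.
exists V.
  by rewrite /Theta_R /=; apply: PV; exists 0 => -[a b] [/= a0 _]; exact/R_gt0.
(* [P n.+1] is the first of the sets to constrain the argument [n]. *)
rewrite /=; apply: filterE => n /=; apply: PV; exists n.+1 => p [_]; exact.
Qed.

(** * The bilateral ideals of rich ultrafilters *)

(** Both operations factor through [G], with [h r = (1, r)] for addition and [h r = (r, 0)] for
    multiplication, so [rich_ultra_G] covers products with a rich left factor. *)
Lemma beta_op_affineE (op : nat -> nat -> nat) (h : nat -> nat * nat) :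
  (forall s r, op s r = G (s, h r)) ->
  forall U V, beta_op op U V = beta_map G (tensor U (beta_map h V)).
Proof.
move=> opG U V; suff -> : op = fun s r => G (s, h r) by apply: beta_eqP.
by apply/funext => s; apply/funext => r; rewrite opG.
Qed.

Lemma rich_ultra_op (op : nat -> nat -> nat) (h : nat -> nat * nat)
    (U V : beta nat) :
  (forall s r, op s r = G (s, h r)) -> V [set r | 0 < (h r).1] ->
  rich_ultra U -> rich_ultra (beta_op op U V).
Proof.
move=> opG Vh rU; rewrite (beta_op_affineE opG); apply: rich_ultra_G => //.
rewrite /Theta_R /=; apply: filterS Vh => r /=.
by case: (h r) => a b; move/R_gt0.
Qed.

Lemma rich_ideal_add : bilateral_ideal (beta_op addn) setT rich_ultra.
Proof.
split=> // [|V U _ rU]; first exact: rich_ultra_neq0.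
split; last first.
  apply: (@rich_ultra_op _ (pair 1)) => // [s r|]; first by rewrite /G /= mul1n.
  exact: filterE.
(* With the rich factor on the right, one [s] whose fibre is in [U] suffices. *)
move=> A; rewrite beta_opE => /beta_ex[s /= /rU rA].
apply: (@AP_rich_affine 1 s) => //; apply: AP_richS rA => r /=.
by rewrite mul1n addnC.
Qed.

Lemma rich_ideal_mul : bilateral_ideal (beta_op muln) beta_pos rich_ultra.
Proof.
split=> [|U rU|V U pV rU]; first exact: rich_ultra_neq0.
(* Otherwise the set of zeros is in [U], but the second term of a progression is positive. *)
- have [//|/rU/(_ 2)[a [d [d0 U0]]]] := beta_memP U [set n | 0 < n].
  by have := U0 1 isT => /=; lia.
split; last first.
  apply: (@rich_ultra_op _ (pair^~ 0)) => // s r.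
  by rewrite /G /= addn0 mulnC.
move=> A; rewrite beta_opE => VUA.
have [s [/= s0 /rU rA]] := beta_ex (filterI pV VUA).
apply: (@AP_rich_affine s 0) => //; apply: AP_richS rA => r.
by rewrite /= addn0.
Qed.

(** A minimal ideal [I] meets [J] in a bilateral ideal, which contains the products [mul i j];
    minimality makes it all of [I]. *)
Lemma minimal_ideal_sub (X : Type) (mul : X -> X -> X) (S J : set X) :
  bilateral_ideal mul S J -> minimal_ideal mul S `<=` J.
Proof.
move=> [[j Jj] JS JJ] x [I [[[i Ii] IS II] minI] Ix].
suff IJE : I `&` J = I by move: Ix; rewrite -IJE => -[].
apply: minI => //; split.
- exists (mul i j); split; first exact: (II j i (JS j Jj) Ii).2.
  exact: (JJ i j (IS i Ii) Jj).1.
- by move=> y [/IS].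
- move=> s u Ss [Iu Ju].
  by have [? ?] := II s u Ss Iu; have [? ?] := JJ s u Ss Ju.
Qed.

(** * Existence of the minimal bilateral ideal *)

Lemma beta_opA (op : nat -> nat -> nat) :
  associative op -> associative (beta_op op).
Proof.
move=> opA U V W; apply: beta_eqP => A.
suff -> : beta_op op U (beta_op op V W) A =
          beta_op op (beta_op op U V) W A by [].
rewrite !beta_opE /=; congr (beta_mem U); apply/funext => s /=.
congr (beta_mem V); apply/funext => t /=.
by congr (beta_mem W); apply/funext => r /=; rewrite opA.
Qed.

(** Minimality is encoded as transitivity: every element of [L] generates [L] by left
    multiplication. For associative [mul] this is equivalent to having no smaller left ideal inside
    [L]. *)
Definition minimal_left_ideal (X : Type) (mul : X -> X -> X) (L : set X) :=
  [/\ L !=set0, forall x l, L l -> L (mul x l) &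
      forall l l', L l -> L l' -> exists x, mul x l = l'].

(* If L is a minimal left ideal of X, then L X is the least bilateral ideal. *)
Lemma minimal_ideal_neq0 (X : Type) (mul : X -> X -> X) (L : set X) :
  associative mul -> minimal_left_ideal mul L ->
  minimal_ideal mul setT !=set0.
Proof.
move=> mulA [[l Ll] LL minL].
exists (mul l l), [set mul u.1 u.2 | u in [set u | L u.1]]; last first.
  by exists (l, l).
split; first split=> //.
- by exists (mul l l), (l, l).
- move=> s _ _ [[m x] /= Lm <-]; split; last first.
    by exists (m, mul x s); rewrite /= ?mulA.
  by exists (mul s m, x); rewrite /= -?mulA //; exact: LL.
move=> J [[j Jj] _ JJ] JI; apply/seteqP; split=> // _ [[m x] /= Lm <-].
have [y <-] := minL (mul j l) m (LL _ _ Ll) Lm.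
apply: (JJ x _ I _).2; apply: (JJ y _ I _).1; exact: (JJ l _ I Jj).2.
Qed.

(* The left ideal is the set of ultrafilters containing F, where F is a maximal
   filter base invariant under A |-> s^-1 A.  It is minimal because, for U in it,
   the sets all of whose translates are in U form such a base too, so are in F. *)
Lemma minimal_left_ideal_beta (op : nat -> nat -> nat) :
  associative op -> exists L, minimal_left_ideal (beta_op op) L.
Proof.
move=> opA.
pose inv (F : set (set nat)) := [/\
  forall A B, F A -> F B -> F (A `&` B), forall A, F A -> A !=set0 &
  forall A s, F A -> F [set r | A (op s r)]].
have [F Finv totF|F [[FI F0 Fop] maxF]] := @Zorn_bigcup (set nat) inv.
  split.
  - move=> A B [X FX XA] [Y FY YB].
    have [XY|YX] := totF _ _ FX FY.
      by exists Y => //; have [YI _ _] := Finv _ FY; apply: YI => //; exact: XY.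
    by exists X => //; have [XI _ _] := Finv _ FX; apply: XI => //; exact: YX.
  - by move=> A [X FX XA]; have [_ X0 _] := Finv _ FX; exact: X0.
  - move=> A s [X FX XA]; exists X => //.
    by have [_ _ Xop] := Finv _ FX; exact: Xop.
pose L := [set U : beta nat | F `<=` U].
have maxE (U : beta nat) A : L U -> (forall s, U [set r | A (op s r)]) -> F A.
  move=> FU UA; pose F' := [set B | forall s, U [set r | B (op s r)]].
  have FF' : F `<=` F' by move=> B FB s; apply: FU; exact: Fop.
  suff invF' : inv F'.
    apply: contrapT => nFA; apply: (maxF F') => //; split => // F'F.
    exact/nFA/F'F.
  split.
  - by move=> B C F'B F'C s; exact: filterI (F'B s) (F'C s).
  - by move=> B /(_ 0)/beta_ex[r Br]; exists (op 0 r).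
  - move=> B s F'B t /=; move: (F'B (op s t)).
    by congr (beta_mem U); apply/funext => r /=; rewrite opA.
exists L; split.
(* The whole set is adjoined to meet the first hypothesis of [beta_extend]. *)
- have [||A|U FU] := @beta_extend nat [set A | A = setT \/ F A].
  + by left.
  + move=> A B [->|FA] [->|FB]; rewrite ?setTI ?setIT;
      by [left|right|right; exact: FI].
  + by case=> [->|/F0 //]; exists 0.
  by exists U => A FA; apply: FU; right.
- move=> U V FV A FA; rewrite beta_opE; apply: filterE => s /=.
  by apply: FV; exact: Fop.
(* A solution [V] of [beta_op op V U = W] has to contain every [Q B] with [B] in [W]. If some [Q B]
   were empty, all translates of the complement of [B] would be in [U], so this complement would be
   in [F] and hence in [W]. *)
move=> U W FU FW; pose Q B := [set s | U [set r | B (op s r)]].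
have [||A|V QV] := @beta_extend nat [set A | exists2 B, W B & A = Q B].
- by exists setT; [exact: filterT|apply/seteqP; split=> // s _; exact: filterT].
- move=> A B [A' WA ->] [B' WB ->]; exists (A' `&` B'); first exact: filterI.
  apply/seteqP; split=> s; first by case; exact: filterI.
  by move=> UAB; split; apply: filterS UAB => r [].
- case=> B WB ->; apply: contrapT => Q0; suff /FW WnB : F (~` B).
    by have [x []] := beta_ex (filterI WB WnB).
  apply: (maxE U) => // s; have [UB|//] := beta_memP U [set r | B (op s r)].
  by case: Q0; exists s.
exists V; apply: beta_eqP => A.
have WV B : W B -> beta_op op V U B.
  by move=> WB; rewrite beta_opE; apply: QV; exists B.
split=> [VUA|/WV //]; have [//|/WV VUnA] := beta_memP W A.
by have [x []] := beta_ex (filterI VUA VUnA).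
Qed.

Lemma K_add_neq0 : K_add !=set0.
Proof.
have [L minL] := minimal_left_ideal_beta addnA.
exact: minimal_ideal_neq0 (beta_opA addnA) minL.
Qed.

(** * The three characterizations *)

Lemma closure_K_rich (U : beta nat) :
  (closure K_add `|` closure K_mul) U -> rich_ultra U.
Proof.
by case=> clU; apply: closure_rich_ultra; apply: closure_subset clU;
  apply: minimal_ideal_sub; [exact: rich_ideal_add|exact: rich_ideal_mul].
Qed.

Lemma maximal_ultraE : maximal_ultra affine = rich_ultra.
Proof.
apply/seteqP; split=> U.
  (* Comparison with one rich [W] suffices: an affine map carries a progression from a member of [W]
     into [B]. *)
  move=> maxU B UB k; have [W rW] := rich_ultra_neq0.
  have [A /rW/(_ k)[c [d [d0 Acd]]] AB] := maxU W B UB.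
  have [||_ [a [b [a0 ->]]] FB] := AB [set c + i * d | i in `I_k].
  - exact/finite_image/finite_II.
  - by move=> _ [i ik <-]; exact: Acd.
  exists (a * c + b), (a * d); split=> [|i ik].
    by rewrite muln_gt0 d0 andbT lt0n; exact/eqP.
  apply: FB; exists (c + i * d); first by exists i.
  by rewrite mulnDr addnAC mulnCA.
(* Conversely the whole of the naturals embeds in [B]: a finite set with maximum [k] lies in an
   initial segment of [k.+1] numbers, an affine copy of which is a progression in [B]. *)
move=> rU V B /rU rB; exists setT; first exact: filterT.
move=> F /finite_seqP[s ->] _; pose k := \max_(n <- s) n.
have [a [d [d0 Bad]]] := rB k.+1.
exists (fun n => d * n + a); first by exists d, a; split=> //; lia.
move=> _ [n /= ns <-]; rewrite addnC mulnC; apply: Bad.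
by rewrite ltnS /k; exact: leq_bigmax_seq.
Qed.

Theorem mainTheorem7 :
  [/\ maximal_ultra affine = [set U : beta nat | forall A, U A -> AP_rich A],
      forall U : beta nat, (closure K_add `|` closure K_mul) U ->
        maximal_ultra affine =
        closure [set beta_map G (tensor U V) | V in Theta_R]
    & forall A : set nat, AP_rich A <->
        forall U : beta nat, closure K_add U ->
          exists2 V, Theta_R V & beta_map G (tensor U V) A].
Proof.
split; first exact: maximal_ultraE.
- move=> U /closure_K_rich rU; rewrite maximal_ultraE; apply/seteqP; split=> W.
    move=> rW; apply/closure_betaP => A /rW/(@AP_rich_G U)[V RV VA].
    by exists (beta_map G (tensor U V)) => //; exists V.
  move=> clW; apply: closure_rich_ultra; apply: closure_subset clW => _ [V RV <-].
  exact: rich_ultra_G.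
- move=> A; split=> [rA U _|KA]; first exact: AP_rich_G.
  have [U KU] := K_add_neq0; have clU := subset_closure KU.
  have [V RV VA] := KA U clU.
  by apply: rich_ultra_G VA => //; apply: closure_K_rich; left.
Qed.
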